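(* Let $f:\mathbb R^m\to\mathbb R$ be a subdifferentiable convex function with $\mathrm{dom}(f)=\mathbb R^m$, let $\bar x\in\mathbb R^m$, and suppose the dual ascent algorithm described in the context is used to solve $\min_{x\in\mathbb R^m} f(x)+\frac12\|x-\bar x\|^2$. Let $\alpha_w\ge 0$ be the gap defined in the context. (1) There is an $O(1/w)$ convergence rate: $\alpha_w=O(1/w)$ as $w\to\infty$. (2) If in addition $\nabla f(\cdot)$ is Lipschitz with constant $L_1$, then there is a linear rate of convergence: there is $\rho\in(0,1)$ such that $\alpha_{w+1}\le\rho\,\alpha_w$ for all $w\ge0$.
   Context: **Algorithm.** Start with an affine function $h_0\le f$. Affine functions are parametrized by $(\tilde x_w,\tilde f_w,\tilde y_w)\in\mathbb R^m\times\mathbb R\times\mathbb R^m$ via $h_w(x)=\tilde y_w^T(x-\tilde x_w)+\tilde f_w$, where $\tilde x_0$ is taken to be the minimizer of $h_0(x)+\frac12\|x-\bar x\|^2$. For $w=0,1,2,\dots$: ($\tilde x_w$ is the minimizer of $h_w(x)+\frac12\|x-\bar x\|^2$.) Choose a subgradient $\tilde s_w\in\partial f(\tilde x_w)$ and set $\tilde h_w(x)=\tilde s_w^T(x-\tilde x_w)+f(\tilde x_w)$. Let $\tilde x_{w+1}$ be the minimizer of $\max\{\tilde h_w,h_w\}(x)+\frac12\|x-\bar x\|^2$, let $\tilde f_{w+1}=\max\{\tilde h_w,h_w\}(\tilde x_{w+1})$ and $\tilde y_{w+1}=\bar x-\tilde x_{w+1}$, and define $h_{w+1}(x)=\tilde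 y_{w+1}^T(x-\tilde x_{w+1})+\tilde f_{w+1}$. **Gap.** Let $x^*$ be the minimizer of $f(x)+\frac12\|x-\bar x\|^2$. Define $$\alpha_w:=\Big[f(x^* )+\tfrac12\|x^*-\bar x\|^2\Big]-\Big[h_w(\tilde x_w)+\tfrac12\|\tilde x_w-\bar x\|^2\Big].$$ *)

(* Defs.v *)
From HB Require Import structures.
From mathcomp Require Import all_boot all_order all_algebra.
From mathcomp Require Import all_classical all_reals all_analysis.
Import Order.TTheory GRing.Theory Num.Theory.
Import numFieldNormedType.Exports.

Set Implicit Arguments.
Unset Strict Implicit.
Unset Printing Implicit Defensive.

Local Open Scope classical_set_scope.
Local Open Scope ring_scope.

Section Defs.
Variables (R : realType) (m : nat).
Implicit Types (f g : 'cV[R]_m -> R) (x y s xbar : 'cV[R]_m).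

Definition dot x y : R := (x^T *m y) 0 0.

(* The library norm on matrices is the sup norm, so the Euclidean norm of R^m
   is defined from the dot product. *)
Definition enorm x : R := Num.sqrt (dot x x).

Definition is_minimizer g x := forall y, g x <= g y.

Definition is_subgradient f x s := forall y, f x + dot s (y - x) <= f y.

Definition subdifferentiable f := forall x, exists s, is_subgradient f x s.

(* Only meaningful where f is differentiable. *)
Definition gradient f x : 'cV[R]_m := \col_i 'D_(delta_mx i 0) f x.

Definition lipschitz_gradient f (L : R) :=
  (forall x, differentiable f x) /\
  (forall x y, enorm (gradient f x - gradient f y) <= L * enorm (x - y)).

Definition affine x0 (v0 : R) y0 : 'cV[R]_m -> R :=
  fun x => dot y0 (x - x0) + v0.

Definition prox_obj g xbar : 'cV[R]_m -> R :=
  fun x => g x + 2^-1 * enorm (x - xbar) ^+ 2.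

Definition max_fun f g : 'cV[R]_m -> R := fun x => Num.max (f x) (g x).

(* xt, ft, yt are the parameters (x~_w, f~_w, y~_w) of the affine minorant
   h_w(x) = y~_w^T (x - x~_w) + f~_w; st is the sequence of chosen subgradients. *)
Section Run.
Variables (f : 'cV[R]_m -> R) (xbar : 'cV[R]_m).
Variables (xt : nat -> 'cV[R]_m) (ft : nat -> R) (yt st : nat -> 'cV[R]_m).

Definition model w : 'cV[R]_m -> R := affine (xt w) (ft w) (yt w).

Definition cut w : 'cV[R]_m -> R := affine (xt w) (f (xt w)) (st w).

Record dual_ascent_run : Prop := DualAscentRun {
  run_init_le : forall x, model 0 x <= f x;
  run_init_min : is_minimizer (prox_obj (model 0) xbar) (xt 0);
  run_subgradient : forall w, is_subgradient f (xt w) (st w);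
  run_X : forall w,
    is_minimizer (prox_obj (max_fun (cut w) (model w)) xbar) (xt w.+1);
  run_F : forall w, ft w.+1 = max_fun (cut w) (model w) (xt w.+1);
  run_Y : forall w, yt w.+1 = xbar - xt w.+1
}.

Definition gap xstar w : R :=
  prox_obj f xbar xstar - prox_obj (model w) xbar (xt w).

End Run.
End Defs.

(* Main.v *)
(* Let [delta] be the amount by which the cut exceeds the model [h w] at [xt w],
   and [g] the difference of their slopes.  Bounding the maximum of cut and model
   below by a convex combination with weight [l] gives
     [alpha w.+1 <= alpha w - (l * delta - l ^+ 2 * |g| ^+ 2 / 2)],
   and [delta] is at least [alpha w].  In general the iterates stay bounded, hence
   so do the subgradients and [g]; taking [l] proportional to [alpha w] yields
   [a' <= a - a ^+ 2 / C] and thus the [O(1/w)] rate.  If the gradient is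
   Lipschitz, then [|g| ^+ 2] is at most a multiple of [delta], since [f - h w] is
   nonnegative along a gradient step; a constant [l] then gives a linear rate. *)
Require Import Defs.
From HB Require Import structures.
From mathcomp Require Import all_boot all_order all_algebra.
From mathcomp Require Import all_classical all_reals all_analysis.
From mathcomp Require Import ring lra.
Import Order.TTheory GRing.Theory Num.Theory.
Import numFieldNormedType.Exports.

Set Implicit Arguments.
Unset Strict Implicit.
Unset Printing Implicit Defensive.

Local Open Scope classical_set_scope.
Local Open Scope ring_scope.

(** * Euclidean inner product on column vectors *)

Section Dot.
Variables (R : realType) (m : nat).
Implicit Types (x y z : 'cV[R]_m).

Lemma dotE x y : dot x y = \sum_i x i 0 * y i 0.
Proof. by rewrite /dot mxE; apply: eq_bigr => i _; rewrite mxE. Qed.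

Lemma dotC x y : dot x y = dot y x.
Proof. by rewrite !dotE; apply: eq_bigr => i _; rewrite mulrC. Qed.

Lemma dotDl x y z : dot (x + y) z = dot x z + dot y z.
Proof. by rewrite /dot linearD mulmxDl mxE. Qed.

Lemma dotDr x y z : dot x (y + z) = dot x y + dot x z.
Proof. by rewrite /dot mulmxDr mxE. Qed.

Lemma dotNl x y : dot (- x) y = - dot x y.
Proof. by rewrite /dot linearN mulNmx mxE. Qed.

Lemma dotNr x y : dot x (- y) = - dot x y.
Proof. by rewrite /dot mulmxN mxE. Qed.

Lemma dotZl a x y : dot (a *: x) y = a * dot x y.
Proof. by rewrite /dot linearZ -scalemxAl mxE. Qed.

Lemma dotZr a x y : dot x (a *: y) = a * dot x y.
Proof. by rewrite /dot -scalemxAr mxE. Qed.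

Lemma dot0r x : dot x 0 = 0.
Proof. by rewrite /dot mulmx0 mxE. Qed.

Definition dot_lin := (dotDl, dotDr, dotNl, dotNr, dotZl, dotZr, dot0r).

Lemma dot_delta x i : dot x (delta_mx i 0) = x i 0.
Proof.
rewrite dotE (bigD1 i) //= mxE !eqxx mulr1 big1 ?addr0 // => j /negbTE ji.
by rewrite mxE ji mulr0.
Qed.

Lemma dot_ge0 x : 0 <= dot x x.
Proof. by rewrite dotE sumr_ge0 // => i _; rewrite -expr2 sqr_ge0. Qed.

Lemma dot_eq0 x : dot x x = 0 -> x = 0.
Proof.
move/eqP; rewrite dotE psumr_eq0 => [/allP x0|i _]; last first.
  by rewrite -expr2 sqr_ge0.
apply/matrixP => i j; rewrite ord1 mxE; apply/eqP.
by have := x0 i (mem_index_enum _); rewrite -expr2 sqrf_eq0.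
Qed.

Lemma dot_coord x i : x i 0 ^+ 2 <= dot x x.
Proof.
rewrite dotE (bigD1 i) //= -expr2 lerDl sumr_ge0 // => j _.
by rewrite -expr2 sqr_ge0.
Qed.

Lemma dot_young x y : 2 * dot x y <= dot x x + dot y y.
Proof.
have := dot_ge0 (x - y); rewrite !dot_lin (dotC y x); lra.
Qed.

Lemma dotB_le x y : dot (x - y) (x - y) <= 2 * dot x x + 2 * dot y y.
Proof.
have := dot_ge0 (x + y); rewrite !dot_lin (dotC y x); lra.
Qed.

Lemma enorm_sqr x : enorm x ^+ 2 = dot x x.
Proof. by rewrite sqr_sqrtr ?dot_ge0. Qed.

End Dot.

(** * Proximal minimizers, subgradients and gradients *)

Section Prox.
Variables (R : realType) (m : nat).
Implicit Types (f M : 'cV[R]_m -> R) (p s x y z xbar : 'cV[R]_m).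

(** Comparing [p] with [p + t *: (z - p)] and dividing by [t] leaves an error of order [t], which
    vanishes as [t] tends to 0. *)
Lemma prox_minimizer_subgradient M xbar p :
  (forall z t, 0 <= t <= 1 -> M (p + t *: (z - p)) <= M p + t * (M z - M p)) ->
  is_minimizer (prox_obj M xbar) p -> is_subgradient M p (xbar - p).
Proof.
move=> Mconv pmin z.
have key t : 0 < t -> t <= 1 ->
    M p + dot (xbar - p) (z - p) <= M z + t * (2^-1 * dot (z - p) (z - p)).
  move=> t0 t1; have := Mconv z t; rewrite t1 ltW //= => /(_ isT) Mt.
  have := pmin (p + t *: (z - p)); rewrite /prox_obj !enorm_sqr.
  rewrite (_ : p + t *: (z - p) - xbar = t *: (z - p) - (xbar - p)); last first.
    by rewrite opprB addrCA addrA.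
  rewrite -(opprB xbar p); move: Mt.
  move: (z - p) (xbar - p) => d q; rewrite !dot_lin (dotC d q) => *.
  by rewrite -(ler_pM2l t0); lra.
apply/ler_addgt0Pr => e e0; set D := 2^-1 * dot (z - p) (z - p) in key.
have D0 : 0 <= D by rewrite mulr_ge0 ?invr_ge0 ?dot_ge0.
pose t := e / (D + e + 1).
have De : 0 < D + e + 1 by lra.
have t0 : 0 < t by rewrite divr_gt0.
have t1 : t <= 1 by rewrite ler_pdivrMr //; lra.
apply: le_trans (key t t0 t1) _; rewrite lerD2l.
rewrite /t mulrAC ler_pdivrMr //; nra.
Qed.

(** With slope [xbar - p] the linear terms cancel when the square is expanded around [p]. *)
Lemma affine_prox p v xbar z :
  prox_obj (affine p v (xbar - p)) xbar z =
  prox_obj (affine p v (xbar - p)) xbar p + 2^-1 * dot (z - p) (z - p).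
Proof.
rewrite /prox_obj /affine !enorm_sqr subrr dot0r -(opprB xbar p).
rewrite (_ : z - xbar = (z - p) - (xbar - p)); last first.
  by rewrite opprB addrA subrK.
move: (z - p) (xbar - p) => d q; rewrite !dot_lin (dotC q d); lra.
Qed.

Lemma affine_convex p v y q z t :
  affine p v y (q + t *: (z - q)) =
  affine p v y q + t * (affine p v y z - affine p v y q).
Proof. by rewrite /affine !dot_lin; lra. Qed.

(** Serves the initial model, whose slope is constrained only through the minimality of [xt 0]. *)
Lemma affine_prox_minimizer p v y xbar :
  is_minimizer (prox_obj (affine p v y) xbar) p -> y = xbar - p.
Proof.
move/prox_minimizer_subgradient => sub.
have {}sub : is_subgradient (affine p v y) p (xbar - p).
  by apply: sub => z t _; rewrite affine_convex.
have := sub (p + (xbar - p - y)); rewrite /affine subrr dot0r.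
rewrite [p + _ - p]addrC addKr => h.
apply/eqP; rewrite eq_sym -subr_eq0; apply/eqP/dot_eq0/eqP.
by rewrite eq_le dot_ge0 andbT; move: h; rewrite (dotDl (xbar - p)) dotNl; lra.
Qed.

(* Testing the subgradient inequality at the vertex of the cube [[-r, r]^m] with
   the signs of [s] bounds the l1 norm of [s] by the values of [f] at finitely
   many points, so no compactness argument is needed. *)
Lemma subgradient_bounded f (D : R) : subdifferentiable f ->
  exists B, forall x s, dot x x <= D -> is_subgradient f x s -> dot s s <= B.
Proof.
(* Since [x i 0 ^+ 2 <= D] forces [|x i 0| <= D + 1], each coordinate of a vertex is at distance at
   least 1 from that of [x]. *)
move=> fsub; have [s0 s0P] := fsub 0; pose r := D + 2.
pose V (b : {ffun 'I_m -> bool}) : 'cV[R]_m := \col_i (if b i then r else - r).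
(* The sum dominates [f] at every vertex; the other terms bound [- f x] via the subgradient [s0] at
   0 and Young's inequality. *)
pose A := \sum_b `|f (V b)| - f 0 + 2^-1 * (dot s0 s0 + D).
exists (A ^+ 2) => x s xD xs.
pose b := [ffun i => 0 <= s i 0].
have s1 : \sum_i `|s i 0| <= dot s (V b - x).
  rewrite dotE; apply: ler_sum => i _; rewrite !mxE ffunE.
  have := le_trans (dot_coord x i) xD; rewrite /r.
  case: ifPn => [s_ge0|]; last rewrite -ltNge => s_lt0.
    rewrite ger0_norm // => xi.
    have : 1 <= D + 2 - x i 0 by nra.
    nra.
  rewrite ltr0_norm // => xi.
  have : - (D + 2) - x i 0 <= -1 by nra.
  nra.
have fV : f (V b) <= \sum_b `|f (V b)|.
  rewrite (bigD1 b) //=; apply: le_trans (ler_norm _) _.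
  by rewrite lerDl sumr_ge0.
have sA : \sum_i `|s i 0| <= A.
  have := dot_young (- s0) x; rewrite !dot_lin opprK.
  have := xs (V b); have := s0P x; rewrite /A subr0; lra.
have siA i : `|s i 0| <= A.
  by apply: le_trans sA; rewrite (bigD1 i) //= lerDl sumr_ge0.
have A0 : 0 <= A by apply: le_trans sA; apply: sumr_ge0.
apply: (@le_trans _ _ (\sum_i `|s i 0| * A)).
  rewrite dotE; apply: ler_sum => i _.
  by rewrite -expr2 -real_normK ?num_real // expr2 ler_wpM2l.
by rewrite -mulr_suml expr2 ler_wpM2r.
Qed.

(** Every difference quotient with a positive step is at least [dot s v]; pass to the right
    limit. *)
Lemma subgradient_derive f x s v : differentiable f x ->
  is_subgradient f x s -> dot s v <= 'D_v f x.
Proof.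
move=> df xs; have /cvg_dnbhs_at_right fv := @diff_derivable _ _ _ _ _ v df.
rewrite /derive -(cvg_lim _ fv) //; apply: limr_ge; first by apply: cvgP fv.
near=> h.
have h0 : 0 < h by near: h; exact: nbhs_right_gt.
rewrite /= /GRing.scale /= ler_pdivlMl //.
by have := xs (h *: v + x); rewrite addrK dotZr; lra.
Unshelve. all: by end_near. Qed.

(** The directions [delta_mx i 0] and its opposite give the two inequalities for coordinate [i]. *)
Lemma subgradient_gradient f x s : differentiable f x ->
  is_subgradient f x s -> s = gradient f x.
Proof.
move=> df xs; apply/matrixP => i j; rewrite ord1 mxE -dot_delta.
apply/eqP; rewrite eq_le subgradient_derive //=.
have := subgradient_derive (- delta_mx i 0) df xs.
by rewrite !deriveE // linearN dotNr lerN2.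
Qed.

(* Using the two subgradient inequalities instead of integrating the gradient
   costs a factor 2 in the usual descent lemma; the constant [(L ^+ 2 + 1) / 2]
   dominates [L] and comes from Young's inequality. *)
Lemma lipschitz_gradient_descent f L x y s : subdifferentiable f ->
  lipschitz_gradient f L -> is_subgradient f x s ->
  f y <= f x + dot s (y - x) + 2^-1 * (L ^+ 2 + 1) * dot (y - x) (y - x).
Proof.
move=> fsub [df fL] xs; have [s' ys'] := fsub y.
have gL : dot (s' - s) (s' - s) <= L ^+ 2 * dot (y - x) (y - x).
  rewrite -!enorm_sqr -exprMn.
  rewrite (subgradient_gradient (df x) xs) (subgradient_gradient (df y) ys').
  (* The sign of [L] is unknown; [fL] itself shows that its right-hand side is nonnegative. *)
  by rewrite ler_sqr ?nnegrE ?(le_trans _ (fL y x)) ?sqrtr_ge0.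
have := ys' x; rewrite -(opprB y x) dotNr.
have := dot_young (s' - s) (y - x); rewrite (dotDl s') dotNl.
lra.
Qed.

End Prox.

(** With [u = a w / C] and [u * w <= 1], the next product is at most
    [C * (1 - u) * (1 + u) <= C]. *)
Lemma quadratic_recursion_rate (R : realType) (a : nat -> R) (C : R) :
  0 < C -> (forall w, 0 <= a w) -> (forall w, a w <= C) ->
  (forall w, a w.+1 <= a w - a w ^+ 2 / C) ->
  forall w, a w * w%:R <= C.
Proof.
move=> C0 a0 aC arec; elim=> [|w IH]; first by rewrite mulr0 ltW.
pose u := a w / C.
have aE : a w = u * C by rewrite divfK ?gt_eqF.
have u0 : 0 <= u by rewrite divr_ge0 // ltW.
have u1 : u <= 1 by rewrite ler_pdivrMr ?mul1r.
have uw : u * w%:R <= 1 by rewrite mulrAC ler_pdivrMr ?mul1r.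
have {}arec : a w.+1 <= u * (1 - u) * C.
  by apply: le_trans (arec w) _; rewrite aE expr2 mulrA mulfK ?gt_eqF //; lra.
have w1 : 0 <= w.+1%:R :> R by [].
apply: le_trans (ler_wpM2r w1 arec) _.
rewrite mulrAC -[leRHS]mul1r ler_wpM2r ?ltW // -natr1.
have : (u * w%:R + u) * (1 - u) <= (1 + u) * (1 - u) by rewrite ler_wpM2r; lra.
nra.
Qed.

(** * Decrease of the gap along a run, and the two rates *)

Section Run.
Variables (R : realType) (m : nat).
Variables (f : 'cV[R]_m -> R) (xbar xstar : 'cV[R]_m).
Variables (xt : nat -> 'cV[R]_m) (ft : nat -> R) (yt st : nat -> 'cV[R]_m).
Hypothesis run : dual_ascent_run f xbar xt ft yt st.
Hypothesis xstar_min : is_minimizer (prox_obj f xbar) xstar.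

Let h := model xt ft yt.
Let c := Defs.cut f xt st.
Let v w := prox_obj (h w) xbar (xt w).
Let delta w := f (xt w) - h w (xt w).
Let g w := st w - yt w.
Let alpha := gap f xbar xt ft yt xstar.

Lemma run_slope w : yt w = xbar - xt w.
Proof.
case: w => [|w]; last exact: run_Y run _.
exact: affine_prox_minimizer (run_init_min run).
Qed.

Lemma prox_model w z :
  prox_obj (h w) xbar z = v w + 2^-1 * dot (z - xt w) (z - xt w).
Proof. by rewrite /v /h /model run_slope affine_prox. Qed.

(** The new model supports the maximum of cut and model at [xt w.+1], and by induction that maximum
    lies below [f]. *)
Lemma model_le w z : h w z <= f z.
Proof.
elim: w z => [|w IH] z; first exact: run_init_le run z.
have sub : is_subgradient (max_fun (c w) (h w)) (xt w.+1) (xbar - xt w.+1).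
  apply: prox_minimizer_subgradient (run_X run w) => {}z t /andP[t0 t1].
  rewrite /max_fun ge_max /c /Defs.cut /h /model !affine_convex.
  set a1 := affine _ _ _ _; set a2 := affine _ _ _ z.
  set b1 := affine _ _ _ (xt w.+1); set b2 := affine _ _ _ z.
  have : a1 <= Num.max a1 b1 by rewrite le_max lexx.
  have : b1 <= Num.max a1 b1 by rewrite le_max lexx orbT.
  have : a2 <= Num.max a2 b2 by rewrite le_max lexx.
  have : b2 <= Num.max a2 b2 by rewrite le_max lexx orbT.
  move: (Num.max _ _) (Num.max _ _) => M2 M1 *; apply/andP; split; nra.
have -> : h w.+1 z = max_fun (c w) (h w) (xt w.+1)
                     + dot (xbar - xt w.+1) (z - xt w.+1).
  by rewrite /h /model /affine run_slope (run_F run) addrC.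
apply: le_trans (sub z) _; rewrite /max_fun ge_max IH andbT.
by have := run_subgradient run w z; rewrite /c /Defs.cut /affine addrC.
Qed.

(** Quadratic growth of the model objective around [xt w]; this is what keeps the iterates
    bounded. *)
Lemma gap_ge_dist w : 2^-1 * dot (xstar - xt w) (xstar - xt w) <= alpha w.
Proof.
have := prox_model w xstar; have := model_le w xstar.
by rewrite /alpha /gap -/h -/(v w) /prox_obj; lra.
Qed.

Lemma gap_ge0 w : 0 <= alpha w.
Proof.
by apply: le_trans (gap_ge_dist w); rewrite mulr_ge0 ?invr_ge0 ?dot_ge0.
Qed.

(** Test the minimality of [xstar] at [xt w]: the quadratic terms cancel. *)
Lemma gap_le_delta w : alpha w <= delta w.
Proof.
have := xstar_min (xt w); rewrite /alpha /gap /delta -/h {2 4}/prox_obj; lra.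
Qed.

(* Bounding the maximum of cut and model below by their convex combination with
   weight [l] and completing the square in the step [xt w.+1 - xt w]. *)
Lemma gap_decrease w l : 0 <= l <= 1 ->
  alpha w.+1 <= alpha w - (l * delta w - 2^-1 * l ^+ 2 * dot (g w) (g w)).
Proof.
move=> /andP[l0 l1]; rewrite /alpha /gap -/h -/(v w) -/(v w.+1).
set d := xt w.+1 - xt w.
(* The new model agrees with the maximum at [xt w.+1]. *)
have vE : v w.+1 = max_fun (c w) (h w) (xt w.+1)
                   + 2^-1 * enorm (xt w.+1 - xbar) ^+ 2.
  by rewrite /v /prox_obj {1}/h /model /affine subrr dot0r add0r (run_F run).
have cE : c w (xt w.+1) = h w (xt w.+1) + delta w + dot (g w) d.
  rewrite /c /Defs.cut /delta /h /model /affine -/d subrr dot0r.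
  by rewrite /g dotDl dotNl; lra.
have hE := prox_model w (xt w.+1); rewrite /prox_obj -/d in hE.
have : c w (xt w.+1) <= max_fun (c w) (h w) (xt w.+1).
  by rewrite /max_fun le_max lexx.
have : h w (xt w.+1) <= max_fun (c w) (h w) (xt w.+1).
  by rewrite /max_fun le_max lexx orbT.
move: (max_fun _ _ _) vE => M vE hM cM.
have sq : 0 <= dot d d + 2 * l * dot (g w) d + l ^+ 2 * dot (g w) (g w).
  have := dot_ge0 (d + l *: g w); move: (d) (g w) => a b.
  rewrite !dot_lin (dotC a b); lra.
have : (1 - l) * h w (xt w.+1) + l * c w (xt w.+1) <= M by nra.
rewrite cE; nra.
Qed.

Lemma gap_noninc w : alpha w.+1 <= alpha w.
Proof.
have := @gap_decrease w 0; rewrite lexx ler01 => /(_ isT); lra.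
Qed.

Lemma gap_le0 w : alpha w <= alpha 0.
Proof. by elim: w => // w; apply: le_trans; apply: gap_noninc. Qed.

Lemma slope_diff_bounded : subdifferentiable f ->
  exists B, forall w, dot (g w) (g w) <= B.
Proof.
move=> fsub.
pose D := 4 * alpha 0 + 2 * dot xstar xstar.
have xD w : dot (xt w) (xt w) <= D.
  have := gap_le0 w; have := gap_ge_dist w.
  have := dotB_le xstar (xstar - xt w); rewrite subKr /D; lra.
have [B BP] := subgradient_bounded D fsub.
exists (2 * B + 2 * (2 * dot xbar xbar + 2 * D)) => w.
have := BP _ _ (xD w) (run_subgradient run w).
have := dotB_le (st w) (yt w); have := dotB_le xbar (xt w).
by have := xD w; rewrite -run_slope /g; lra.
Qed.

Lemma gap_sublinear : subdifferentiable f ->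
  alpha =O_\oo (fun w => w%:R^-1 : R).
Proof.
move=> fsub; have [B0 B0P] := slope_diff_bounded fsub.
pose B := `|B0| + alpha 0 + 1.
have a0 := gap_ge0 0.
have B_gt0 : 0 < B by have := normr_ge0 B0; rewrite /B; lra.
have aB w : alpha w <= B.
  by have := gap_le0 w; have := normr_ge0 B0; rewrite /B; lra.
have gB w : dot (g w) (g w) <= B.
  by have := B0P w; have := ler_norm B0; rewrite /B; lra.
have C0 : 0 < 2 * B by lra.
have aw : forall w, alpha w * w%:R <= 2 * B.
  apply: quadratic_recursion_rate => // w; first exact: gap_ge0.
    by have := aB w; lra.
  (* This weight maximizes [l * alpha w - l ^+ 2 * B / 2], with value [alpha w ^+ 2 / (2 * B)]. *)
  pose l := alpha w / B.
  have aE : alpha w = l * B by rewrite divfK ?gt_eqF.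
  have l0 : 0 <= l by rewrite divr_ge0 ?gap_ge0 // ltW.
  have l1 : l <= 1 by rewrite ler_pdivrMr ?mul1r.
  have -> : alpha w ^+ 2 / (2 * B) = 2^-1 * l ^+ 2 * B.
    by rewrite /l; field; rewrite gt_eqF.
  have l01 : 0 <= l <= 1 by rewrite l0.
  apply: le_trans (gap_decrease w l01) _.
  have := gap_le_delta w; have := gB w; rewrite {2}aE => gw dw.
  have : l * alpha w <= l * delta w by rewrite ler_wpM2l.
  have : l ^+ 2 * dot (g w) (g w) <= l ^+ 2 * B by rewrite ler_wpM2l ?sqr_ge0.
  rewrite {1}aE; lra.
(* At [w = 0] the inverse is 0 by convention, so only [w > 0] is considered. *)
apply/eqO_exP; exists (2 * B) => //; near=> w.
have w0 : 0 < w%:R :> R by rewrite ltr0n; near: w; exact: nbhs_infty_gt.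
rewrite ger0_norm ?gap_ge0 // normfV (ger0_norm (ltW w0)).
by rewrite ler_pdivlMr.
Unshelve. all: by end_near. Qed.

Lemma gap_linear L : subdifferentiable f -> lipschitz_gradient f L ->
  exists rho : R, [/\ 0 < rho, rho < 1
    & forall w, alpha w.+1 <= rho * alpha w].
Proof.
(* As [l ^+ 2 * (2 * K) = l], half of the gain [l * delta w] survives, whence the factor
   [1 - l / 2]. *)
move=> fsub fL; pose K := L ^+ 2 + 1; pose l := (2 * K)^-1.
have K1 : 1 <= K by rewrite /K lerDr sqr_ge0.
have K0 : 0 < 2 * K by lra.
have lK : l * K = 2^-1 by rewrite /l; field; rewrite gt_eqF //; lra.
have l0 : 0 < l by rewrite invr_gt0.
have l1 : l <= 2^-1 by rewrite lef_pV2 ?posrE //; lra.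
exists (1 - l / 2); split; [lra|lra|move=> w].
have l01 : 0 <= l <= 1 by apply/andP; split; lra.
(* A gradient step of length [K^-1] for [f - h w] from [xt w] cannot go below
   [0], so the squared slope difference is controlled by [delta w]. *)
have gdelta : dot (g w) (g w) <= 2 * K * delta w.
  pose t := 2 * l; pose z := xt w - t *: g w.
  have tK : t * K = 1 by rewrite /t -mulrA lK; lra.
  have zE : z - xt w = - (t *: g w) by rewrite /z addrC addKr.
  have := lipschitz_gradient_descent z fsub fL (run_subgradient run w).
  have := model_le w z; rewrite /delta /h /model /affine -/K zE subrr.
  have gE : dot (g w) (g w) = dot (st w) (g w) - dot (yt w) (g w).
    by rewrite {1}/g dotDl dotNl.
  rewrite !(dotNr, dotNl, dotZr, dotZl, dot0r) => hz fz.
  have KtK u : K * (t * u) = u by rewrite (mulrA K t) (mulrC K) tK mul1r.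
  have tG : t * dot (g w) (g w) <= 2 * (f (xt w) - (0 + ft w)).
    by have := KtK (t * dot (g w) (g w)); move: hz fz; rewrite gE; lra.
  have : K * (t * dot (g w) (g w)) <= K * (2 * (f (xt w) - (0 + ft w))).
    by rewrite ler_wpM2l //; lra.
  by rewrite KtK; lra.
have := gap_decrease w l01; have := gap_le_delta w.
have : l ^+ 2 * dot (g w) (g w) <= l ^+ 2 * (2 * K * delta w).
  by rewrite ler_wpM2l ?sqr_ge0.
have -> : l ^+ 2 * (2 * K * delta w) = l * delta w.
  have -> : l ^+ 2 * (2 * K * delta w) = 2 * l * (l * K) * delta w by ring.
  by rewrite lK; lra.
move=> *; have : l * alpha w <= l * delta w by rewrite ler_wpM2l // ltW.
lra.
Qed.

End Run.

Theorem theorem2p6 (R : realType) (m : nat)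
    (f : 'cV[R]_m -> R) (xbar xstar : 'cV[R]_m)
    (xt : nat -> 'cV[R]_m) (ft : nat -> R) (yt st : nat -> 'cV[R]_m)
    (f_convex : convex_function [set: 'cV[R]_m] f)
    (f_subdiff : subdifferentiable f)
    (run : dual_ascent_run f xbar xt ft yt st)
    (xstar_min : is_minimizer (prox_obj f xbar) xstar) :
  let alpha : nat -> R := gap f xbar xt ft yt xstar in
  [/\ forall w, 0 <= alpha w,
      alpha =O_\oo (fun w => w%:R^-1 : R)
    & forall L1 : R, lipschitz_gradient f L1 ->
      exists rho : R, [/\ 0 < rho, rho < 1
        & forall w, alpha w.+1 <= rho * alpha w]].
Proof.
split; first exact: gap_ge0 run.
- exact: gap_sublinear run xstar_min f_subdiff.
- move=> L1; exact: (gap_linear run xstar_min f_subdiff).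
Qed.
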